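(* Let $\mathcal H$ be a Hilbert space, let $E\colon\mathcal H\to\mathbb R$ be differentiable, let $\Theta=\mathbb R^p$, and let $P\colon\Theta\to\mathcal H$, $\theta\mapsto u_\theta$, be a differentiable parametrization. Put $L(\theta)=E(u_\theta)$. Consider a function space algorithm of the form $$u_{k+1}=u_k+\eta_k d_k,\qquad d_k=-T_{u_k}^{-1}(DE(u_k)),$$ with step sizes $\eta_k$, where each $T_u\colon\mathcal H\to\mathcal H^*$ is a bounded, linear, invertible map. Consider the discretized algorithm in parameter space $$\theta_{k+1}=\theta_k-\eta_k\,G(\theta_k)^\dagger\nabla L(\theta_k),\qquad G(\theta)_{ij}=\langle T_{u_\theta}\partial_{\theta_i}u_\theta,\partial_{\theta_j}u_\theta\rangle ,\quad 1\le i,j\le p .$$ Assume additionally that the maps $T_{u_{\theta_k}}$ are symmetric and positive definite. Then for the discretized algorithm it holds that $$u_{\theta_{k+1}}=u_{\theta_k}-\eta_k\,\Pi_{u_{\theta_k}}\big[T_{u_{\theta_k}}^{-1}(DE(u_{\theta_k}))\big]+\epsilon_k,$$ where $\Pi_{u_{\theta_k}}$ denotes the orthogonal projection onto the tangent space $\operatorname{span}\{\partial_{\theta_1}u_{\theta_k},\dots,\partial_{\theta_p}u_{\theta_k}\}$ with respect to the inner product $\langle T_{u_{\theta_k}}\cdot,\cdot\rangle$. The term $\epsilon_k$ corresponds to an error vanishing quadratically in the step and step size length, $$\epsilon_k=O\big(\eta_k^2\,\lVert G(\theta_k)^\dagger\nabla L(\theta_k)\rVert^2\big).$$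
   Context: $\langle\cdot,\cdot\rangle$ denotes the dual pairing between $\mathcal H^*$ and $\mathcal H$; $DE(u)\in\mathcal H^*$ is the Fréchet derivative of $E$ at $u$. $T_u$ is symmetric if $\langle T_u v,w\rangle=\langle T_u w,v\rangle$ for all $v,w\in\mathcal H$, and positive definite if $\langle T_u v,v\rangle>0$ for all $v\neq0$. $DP(\theta)$ is the derivative of the parametrization and $\partial_{\theta_i}u_\theta=DP(\theta)e_i\in\mathcal H$ are its partial derivatives, where $e_i$ is the $i$-th standard basis vector of $\mathbb R^p$; they may be linearly dependent, and their span $\operatorname{ran}(DP(\theta))$ is called the generalized tangent space of the model $\mathcal M=\{u_\theta:\theta\in\Theta\}\subseteq\mathcal H$ at $u_\theta$. The typical case is that $u_\theta$ is a neural network with parameters $\theta$, but the setting is meaningful for general parametric classes. $G(\theta)^\dagger$ denotes a pseudo-inverse of the Gramian matrix $G(\theta)\in\mathbb R^{p\times p}$, i.e. a matrix satisfying $G(\theta)G(\theta)^\dagger G(\theta)=G(\theta)$. The error term arises from the Taylor expansion of $P$ at $\theta_k$: with $w_k=-G(\theta_k)^\dagger\nabla L(\theta_k)$, one has $u_{\theta_{k+1}}=P(\theta_k+\eta_k w_k)=u_{\theta_k}+\eta_k DP(\theta_k)w_k+O(\eta_k^2\lVert w_k\rVert^2)$.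
   Formalization: Differentiability of P alone does not give the quadratic error (e.g. P(t)=t+|t|^{3/2} at 0); it is additionally assumed that DP is Lipschitz at each iterate θ_k: ‖DP(θ)−DP(θ_k)‖ ≤ K‖θ−θ_k‖ for θ near θ_k. *)

(* Defs.v *)
From HB Require Import structures.
From mathcomp Require Import all_boot all_order all_algebra sesquilinear.
From mathcomp Require Import all_classical all_reals all_analysis.

Set Implicit Arguments.
Unset Strict Implicit.
Unset Printing Implicit Defensive.

Import Order.TTheory GRing.Theory Num.Theory.
Import numFieldNormedType.Exports.

Local Open Scope classical_set_scope.
Local Open Scope ring_scope.

(* A real Hilbert space is a complete normed space whose norm comes from the
   positive definite symmetric form [ip]. *)
Definition hilbert_norm (R : realType) (H : completeNormedModType R)
    (ip : {dot H for @idfun R}) : Prop :=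
  forall x : H, `|x| ^+ 2 = ip x x.

Section Operators.
Context {R : realType} {H : normedModType R}.

(* The topological dual, as a set of functions; [H -> R^o] carries its pointwise vector space
   structure, and the pairing of [f] with [w] is the application [f w]. *)
Definition dual : set (H -> R^o) := [set f | linear f /\ continuous f].

Implicit Type T : {linear H -> (H -> R^o)}.

(* The second clause bounds the dual norm of [T v] by [M * `|v|]; the inverse is
   then bounded too, by the bounded inverse theorem. *)
Definition bounded_invertible T : Prop :=
  set_bij [set: H] dual T /\
  exists M : R, forall v w : H, `|T v w| <= M * `|v| * `|w|.

Definition op_inv T : (H -> R^o) -> H := 'pinv_(fun=> 0) [set: H] T.

Definition symmetric_op T : Prop := forall v w : H, T v w = T w v.

Definition posdef_op T : Prop := forall v : H, v != 0 -> 0 < T v v.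

Definition is_orth_proj T (V : set H) (x y : H) : Prop :=
  V y /\ forall z, V z -> T (x - y) z = 0.

(* The default value of [xget] is irrelevant when [T] is symmetric positive
   definite and [V] is a finite-dimensional subspace: the projection then exists
   and is unique. *)
Definition orth_proj T (V : set H) (x : H) : H :=
  xget 0 [set y | is_orth_proj T V x y].

End Operators.

Section ParameterSpace.
Context {R : realType} {H : normedModType R} {p : nat}.

(* The library norm on ['cV[R]_p] is the max norm. *)
Definition enorm (v : 'cV[R]_p) : R := Num.sqrt (\sum_(i < p) v i 0 ^+ 2).

Definition partial (V : normedModType R) (f : 'cV[R]_p -> V)
    (th : 'cV[R]_p) (i : 'I_p) : V :=
  'd f th (delta_mx i 0).

Definition grad (L : 'cV[R]_p -> R^o) (th : 'cV[R]_p) : 'cV[R]_p :=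
  \col_i partial L th i.

Definition tangent_space (P : 'cV[R]_p -> H) (th : 'cV[R]_p) : set H :=
  [set v | exists c : 'I_p -> R, v = \sum_(i < p) c i *: partial P th i].

(* Lipschitz continuity of the derivative at the single point [th]; it holds if
   [P] is twice differentiable at [th] or if its derivative is Lipschitz near
   [th].  Mere differentiability does not give a quadratic Taylor remainder:
   take [P t = t + |t|^(3/2)] at [t = 0]. *)
Definition deriv_lipschitz_at (P : 'cV[R]_p -> H) (th : 'cV[R]_p) : Prop :=
  exists K : R, \forall th' \near th, forall v : 'cV[R]_p,
    `|'d P th' v - 'd P th v| <= K * `|th' - th| * `|v|.

Definition gram (P : 'cV[R]_p -> H) (T : H -> {linear H -> (H -> R^o)})
    (th : 'cV[R]_p) : 'M[R]_p :=
  \matrix_(i, j) T (P th) (partial P th i) (partial P th j).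

Definition pseudo_inverse (G Gd : 'M[R]_p) : Prop := G *m Gd *m G = G.

Definition discretized_algorithm (L : 'cV[R]_p -> R^o)
    (Gd : 'cV[R]_p -> 'M[R]_p) (eta : nat -> R)
    (theta : nat -> 'cV[R]_p) : Prop :=
  forall k, theta k.+1 = theta k - eta k *: (Gd (theta k) *m grad L (theta k)).

End ParameterSpace.

(* Main.v *)
Require Import Defs.
From HB Require Import structures.
From mathcomp Require Import all_boot all_order all_algebra sesquilinear.
From mathcomp Require Import all_classical all_reals all_analysis.
From mathcomp Require Import lra.
Import Order.TTheory GRing.Theory Num.Theory.
Import numFieldNormedType.Exports.
Local Open Scope classical_set_scope.
Local Open Scope ring_scope.

(** Let [th] be the current parameter, [G] the Gramian, [g = grad (E \o P) th]
    and [w = Gd *m g], so that the step is [- eta *: w].  Two independent facts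
    combine.

    To first order the iterate moves by [- eta *: 'd P th w], and [orth_proj_gram]
    identifies ['d P th w] with the projection of [d = T^-1 (DE)].  Indeed, for any
    [c], the [j]-th entry of [G *m c] is [T ('d P th c) (partial P th j)], while by
    the chain rule the [j]-th entry of [g] is [DE (partial P th j)], that is
    [T d (partial P th j)].  Hence ['d P th c] is the projection of [d] exactly when
    [c] solves the normal equations [G *m c = g].  A pseudo-inverse yields a
    solution of a consistent system, so the point is that [g] lies in the range of
    [G], even if the partial derivatives are dependent ([gram_solvable]): [G] is
    symmetric, so its range is the annihilator of its kernel, and if [G *m v = 0]
    then ['d P th v = 0] by definiteness, so that [g] kills [v].

    The remainder is that of the first-order Taylor expansion of [P]
    ([taylor_quadratic]).  The derivative of [P] is Lipschitz at [th], so for small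
    [h] the map [t |-> P (th + t *: h) - t *: 'd P th h] has derivative of norm at most
    [K * `|h| ^+ 2] on the unit interval, and the mean value inequality
    applies.  The constants are those of the expansion at [th]; they involve
    neither the pseudo-inverse nor the step sizes. *)

(** * Quadratic Taylor remainder in a Hilbert space *)

Section InnerProduct.
Context {R : realType} {H : completeNormedModType R} (ip : {dot H for @idfun R}).
Hypothesis hH : hilbert_norm ip.

(** Since the norm is already known to satisfy the triangle inequality, comparing
    [`|u + v| ^+ 2] with [(`|u| + `|v|) ^+ 2] leaves exactly this bound on the cross
    term. *)
Lemma cauchy_schwarz (x y : H) : `|ip x y| <= `|x| * `|y|.
Proof.
have ip_le (u v : H) : ip u v <= `|u| * `|v|.
  have : `|u + v| ^+ 2 <= (`|u| + `|v|) ^+ 2.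
    by rewrite ler_pXn2r ?nnegrE ?addr_ge0// ler_normD.
  rewrite sqrrD !hH (hnormD ip u v)/= expr0 mul1r; lra.
rewrite ler_norml ip_le andbT lerNl -linearNr.
by apply: le_trans (ip_le _ _) _; rewrite normrN.
Qed.

(** The form retyped as a map into [R^o], so that it can carry the structure of a
    linear map between normed modules. *)
Definition ip_with (y : H) : H -> R^o := ip y.

Lemma ip_with_linear (y : H) : linear (ip_with y).
Proof. by move=> a u v; rewrite /ip_with linearPr. Qed.

HB.instance Definition _ (y : H) :=
  GRing.isLinear.Build R H R^o _ (ip_with y) (ip_with_linear y).

Lemma ip_with_continuous (y : H) : continuous (ip_with y).
Proof.
apply: bounded_linear_continuous; apply/linear_boundedP.
apply: filterS (nbhs_pinfty_ge (num_real `|y|)) => M yM x.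
by apply: (le_trans (cauchy_schwarz _ _)); rewrite ler_wpM2r.
Qed.

(** Vector-valued functions have no mean value theorem, but the scalar function
    [ip y (g t)] has one; the choice [y = g 1 - g 0] makes its increment equal to
    [`|y| ^+ 2], and Cauchy-Schwarz lets one factor [`|y|] cancel. *)
Lemma mean_value_inequality (g dg : R -> H) (M : R) :
  (forall t : R, is_derive t 1 g (dg t)) ->
  (forall t, t \in `]0, 1[ -> `|dg t| <= M) ->
  `|g 1 - g 0| <= M.
Proof.
move=> hg hM; set y := g 1 - g 0.
have hf (t : R) : is_derive t 1 (ip_with y \o g : R -> R) (ip y (dg t)).
  have dgt : differentiable g t.
    by apply/derivable1_diffP; exact: (@ex_derive _ _ _ _ _ _ _ (hg t)).
  have dl : differentiable (ip_with y) (g t).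
    by apply: linear_differentiable; exact: ip_with_continuous.
  apply: DeriveDef.
    by apply: diff_derivable; exact: differentiable_comp.
  rewrite deriveE; last exact: differentiable_comp.
  rewrite diff_comp//= diff_lin; last exact: ip_with_continuous.
  by rewrite -deriveE// derive_val.
have [c hc] := @MVT R _ _ 0 1 ltr01 (fun t _ => hf t)
  (@continuous_subspaceT _ _ _ _ (fun t => differentiable_continuous
     (proj1 (derivable1_diffP _ _) (@ex_derive _ _ _ _ _ _ _ (hf t))))).
rewrite subr0 mulr1 -[LHS](@raddfB _ _ (ip_with y)) -/y.
rewrite [LHS](esym (hH y)) => ycE.
have [->|y0] := eqVneq y 0.
  by rewrite normr0; exact: le_trans (hM _ hc).
have ygt0 : 0 < `|y| by rewrite normr_gt0.
rewrite -(ler_pM2l ygt0) -expr2 ycE.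
apply: le_trans (ler_norm _) _; apply: le_trans (cauchy_schwarz _ _) _.
by rewrite ler_pM2l// hM.
Qed.

(** Second-order differentiability is not available, so the remainder is bounded by
    the mean value inequality along the segment from [th] to [th + h], on which the
    derivative differs from its value at [th] by at most [K * `|h|]. *)
Lemma taylor_quadratic (p : nat) (P : 'cV[R]_p -> H)
    (hP : forall th, differentiable P th) (th : 'cV[R]_p) :
  deriv_lipschitz_at P th ->
  exists C delta : R, [/\ 0 < C, 0 < delta &
    forall h : 'cV[R]_p, `|h| <= delta ->
      `|P (th + h) - P th - 'd P th h| <= C * `|h| ^+ 2].
Proof.
move=> [K /nbhs_ballP[r /= r0 hK]].
(* The Lipschitz constant may be negative or zero, hence the strictly positive
   [`|K| + 1]; halving the radius turns the open ball into a closed one. *)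
exists (`|K| + 1), (r / 2); split; [by rewrite ltr_wpDl|by rewrite divr_gt0|].
move=> h hr.
pose g (t : R) := P (th + t *: h) - t *: 'd P th h.
pose dg (t : R) := 'd P (th + t *: h) h - 'd P th h.
have hg (t : R) : is_derive t 1 g (dg t).
  have line : is_diff t (fun s : R => th + s *: h) ( *:%R^~ h).
    by apply: is_diff_eq; rewrite add0r.
  have Pdiff : is_diff (th + t *: h) P ('d P (th + t *: h)).
    exact/differentiableP.
  have hgd : is_diff t g ( *:%R^~ (dg t)).
    apply: is_diff_eq; apply/funext => s /=.
    by rewrite /dg scalerBr -[X in _ = X - _]linearZ.
  by apply: DeriveDef; [exact: diff_derivable|rewrite deriveE// diff_val scale1r].
have := @mean_value_inequality g dg ((`|K| + 1) * `|h| ^+ 2) hg.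
rewrite /g !scale1r scale0r addr0 scale0r subr0 addrAC; apply.
move=> t; rewrite in_itv/= => /andP[t0 t1].
have th_le : `|t *: h| <= `|h|.
  by rewrite normrZ gtr0_norm// ler_piMl// ltW.
have /hK/(_ h) : ball th r (th + t *: h).
  rewrite -ball_normE/= opprD addNKr normrN.
  by apply: le_lt_trans th_le _; apply: le_lt_trans hr _; lra.
have -> : th + t *: h - th = t *: h by rewrite addrC addKr.
move=> /le_trans; apply.
rewrite [`|h| ^+ 2]expr2 mulrA; apply: ler_wpM2r => //.
apply: (@le_trans _ _ (`|K| * `|t *: h|)); first by rewrite ler_wpM2r// ler_norm.
by apply: ler_pM => //; lra.
Qed.

End InnerProduct.

(** * The Gramian step is an orthogonal projection *)

Lemma enorm_ge (R : realType) (p : nat) (v : 'cV[R]_p) : `|v| <= enorm v.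
Proof.
rewrite [leLHS]mx_normrE; apply/bigmax_leP; split; first exact: sqrtr_ge0.
move=> [i j] _ /=; rewrite (ord1 j) -sqrtr_sqr ler_wsqrtr//.
by rewrite (bigD1 i)//= lerDl sumr_ge0// => k _; exact: sqr_ge0.
Qed.

Section Projection.
Context {R : realType} {H : normedModType R}.

(** Two candidates differ by an element of [V] that is orthogonal to [V], hence to
    itself. *)
Lemma orth_proj_unique (T : {linear H -> (H -> R^o)}) (V : set H) (x y : H) :
  posdef_op T -> (forall a b, V a -> V b -> V (a - b)) ->
  is_orth_proj T V x y -> orth_proj T V x = y.
Proof.
move=> Tpos VB [Vy hy]; apply: xget_unique; first by split.
move=> z [Vz hz]; apply/eqP; rewrite eq_sym -subr_eq0; apply: contraT => /Tpos.
have dE : (x - z) - (x - y) = y - z by rewrite opprB [LHS]addrC addrA subrK.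
rewrite -[in T _]dE linearB [X in 0 < X](_ : _ = T (x - z) (y - z) - T (x - y) (y - z))//.
by rewrite hz ?hy ?subrr ?ltxx//; exact: VB.
Qed.

Variables (p : nat) (P : 'cV[R]_p -> H) (th : 'cV[R]_p).

Lemma diff_partial (V : normedModType R) (f : 'cV[R]_p -> V) (v : 'cV[R]_p) :
  'd f th v = \sum_(i < p) v i 0 *: partial f th i.
Proof.
rewrite [in LHS](matrix_sum_delta v) linear_sum; apply: eq_bigr => i _.
by rewrite big_ord1 linearZ.
Qed.

(** The span of the partial derivatives is a range, so every tangent vector
    comes with a parameter direction that represents it. *)
Lemma tangent_spaceE : tangent_space P th = range ('d P th).
Proof.
apply/seteqP; split => [v [c ->]|_ [c _ <-]].
  exists (\col_i c i) => //; rewrite diff_partial.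
  by apply: eq_bigr => i _; rewrite mxE.
by exists (fun i => c i 0); exact: diff_partial.
Qed.

Variables (T : H -> {linear H -> (H -> R^o)}).
Hypothesis hT : bounded_invertible (T (P th)).
Hypothesis Tsym : symmetric_op (T (P th)).
Hypothesis Tpos : posdef_op (T (P th)).

Lemma linear_diff_partial (f : H -> R^o) (v : 'cV[R]_p) : linear f ->
  f ('d P th v) = \sum_(i < p) v i 0 * f (partial P th i).
Proof.
move=> flin; pose f' : {linear H -> R^o} :=
  HB.pack f (GRing.isLinear.Build _ _ _ _ f flin).
rewrite -[f]/(f' : _ -> _) diff_partial linear_sum.
by apply: eq_bigr => i _; rewrite linearZ.
Qed.

Lemma bounded_invertible_linear (z : H) : linear (T (P th) z).
Proof. by have [[TS _ _] _] := hT; have [] := TS z I. Qed.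

(** Multiplying by the Gramian tests a tangent vector against the partial
    derivatives: this is the link between the matrix equation and orthogonality. *)
Lemma gram_mulE (w : 'cV[R]_p) (j : 'I_p) :
  (gram P T th *m w) j 0 = T (P th) ('d P th w) (partial P th j).
Proof.
rewrite Tsym linear_diff_partial; last exact: bounded_invertible_linear.
by rewrite mxE; apply: eq_bigr => i _; rewrite mxE mulrC.
Qed.

Lemma gram_sym : (gram P T th)^T = gram P T th.
Proof. by apply/matrixP => i j; rewrite !mxE Tsym. Qed.

(** Dependent partial derivatives make the Gramian singular, but definiteness of
    the form ensures that only the directions that do not move [P] are lost. *)
Lemma gram_ker (w : 'cV[R]_p) : gram P T th *m w = 0 -> 'd P th w = 0.
Proof.
move=> Gw0; apply/eqP; apply: contraT => /Tpos.
rewrite linear_diff_partial; last exact: bounded_invertible_linear.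
by rewrite big1 ?ltxx// => i _; rewrite -gram_mulE Gw0 mxE mulr0.
Qed.

(** The normal equations are consistent because the range of a symmetric matrix is
    the annihilator of its kernel, and the right-hand side vanishes on that kernel
    by [gram_ker]. *)
Lemma gram_solvable (f : H -> R^o) : linear f ->
  exists c : 'cV[R]_p, \col_i f (partial P th i) = gram P T th *m c.
Proof.
move=> flin; set b := \col_i _.
suff /submxP[D bE] : (b^T <= gram P T th)%MS.
  by exists D^T; rewrite -[LHS]trmxK bE trmx_mul gram_sym.
(* The columns of the cokernel matrix span the kernel of the Gramian. *)
rewrite submxE; apply/eqP/matrixP => i j; rewrite ord1 [RHS]mxE.
pose v := col j (cokermx (gram P T th)).
have dv0 : 'd P th v = 0.
  by apply: gram_ker; rewrite /v colE mulmxA mulmx_coker mul0mx.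
have f0 : f 0 = 0 by have := flin (-1) 0 0; rewrite scaler0 addr0 scaleN1r addNr.
rewrite -[RHS]f0 -dv0 linear_diff_partial// mxE.
by apply: eq_bigr => k _; rewrite !mxE mulrC.
Qed.

(** The defining equation [G *m Gd *m G = G] sends any right-hand side in the range of
    [G] to a solution, and solutions of the normal equations represent the
    projection of the vector that [T] maps to [f]. *)
Lemma orth_proj_gram (f : H -> R^o) (Gd : 'M[R]_p) :
  dual f -> pseudo_inverse (gram P T th) Gd ->
  orth_proj (T (P th)) (tangent_space P th) (op_inv (T (P th)) f) =
  'd P th (Gd *m \col_i f (partial P th i)).
Proof.
move=> fdual hGd; have [flin _] := fdual.
have [c bE] := gram_solvable f flin; set b := \col_i _ in bE *.
have GGdb : gram P T th *m (Gd *m b) = b by rewrite bE !mulmxA hGd.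
have TinvK : T (P th) (op_inv (T (P th)) f) = f.
  by apply: pinvK; rewrite inE; have [[_ _ TS] _] := hT; exact: TS.
rewrite tangent_spaceE; apply: orth_proj_unique => //.
  by move=> _ _ [v _ <-] [w _ <-]; exists (v - w) => //; rewrite linearB.
split; first by exists (Gd *m b).
move=> _ [w _ <-]; rewrite linear_diff_partial; last exact: bounded_invertible_linear.
apply: big1 => i _; rewrite linearB [X in _ * X](_ : _ =
  T (P th) (op_inv (T (P th)) f) (partial P th i) -
  T (P th) ('d P th (Gd *m b)) (partial P th i))//.
by rewrite TinvK -gram_mulE GGdb mxE subrr mulr0.
Qed.

End Projection.

(** * The discretized algorithm *)

Theorem theorem1 (R : realType) (H : completeNormedModType R)
    (ip : {dot H for @idfun R}) (hH : hilbert_norm ip)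
    (E : H -> R^o) (hE : forall u : H, differentiable E u)
    (p : nat) (P : 'cV[R]_p -> H)
    (hP : forall th : 'cV[R]_p, differentiable P th)
    (T : H -> {linear H -> (H -> R^o)})
    (hT : forall u : H, bounded_invertible (T u)) :
  exists C delta : 'cV[R]_p -> R,
    (forall th : 'cV[R]_p, 0 < C th /\ 0 < delta th) /\
    forall (Gd : 'cV[R]_p -> 'M[R]_p) (eta : nat -> R) (theta : nat -> 'cV[R]_p),
      (forall th : 'cV[R]_p, pseudo_inverse (gram P T th) (Gd th)) ->
      discretized_algorithm (E \o P) Gd eta theta ->
      (forall k : nat, deriv_lipschitz_at P (theta k)) ->
      (forall k : nat, symmetric_op (T (P (theta k))) /\
                       posdef_op (T (P (theta k)))) ->
      exists eps : nat -> H, forall k : nat,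
        P (theta k.+1) =
          P (theta k)
          - eta k *: orth_proj (T (P (theta k))) (tangent_space P (theta k))
                       (op_inv (T (P (theta k))) ('d E (P (theta k))))
          + eps k
        /\ (`|eta k| * enorm (Gd (theta k) *m grad (E \o P) (theta k))
              <= delta (theta k) ->
            `|eps k| <= C (theta k) * (eta k ^+ 2 *
              enorm (Gd (theta k) *m grad (E \o P) (theta k)) ^+ 2)).
Proof.
(* The constants may depend on the parameter alone, so they are chosen for all
   parameters at once; where the derivative is not Lipschitz the value is
   arbitrary. *)
have /choice[CD hCD] : forall th : 'cV[R]_p, exists cd : R * R,
    [/\ 0 < cd.1, 0 < cd.2 & deriv_lipschitz_at P th ->
      forall h : 'cV[R]_p, `|h| <= cd.2 ->
        `|P (th + h) - P th - 'd P th h| <= cd.1 * `|h| ^+ 2].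
  move=> th; have [/(taylor_quadratic ip hH p P hP)[C [d [C0 d0 hC]]]|nLip] :=
    pselect (deriv_lipschitz_at P th); first by exists (C, d).
  by exists (1, 1); split.
exists (fun th => (CD th).1), (fun th => (CD th).2).
split=> [th|Gd eta theta hGd halg hLip hTpd]; first by have [] := hCD th.
pose w k := Gd (theta k) *m grad (E \o P) (theta k).
exists (fun k => P (theta k - eta k *: w k) - P (theta k)
               - 'd P (theta k) (- (eta k *: w k))) => k.
have [Tsym Tpos] := hTpd k; have [C0 _ hC] := hCD (theta k).
have gradE : grad (E \o P) (theta k) =
    \col_i 'd E (P (theta k)) (partial P (theta k) i).
  by apply/matrixP => i j; rewrite !mxE /partial diff_comp.
have dEdual : dual ('d E (P (theta k))).
  by split; [exact: linearP|exact: diff_continuous].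
split.
  rewrite (orth_proj_gram p P (theta k) T (hT _) Tsym Tpos _ _ dEdual (hGd (theta k))) -gradE.
  rewrite halg -/(w k).
  have -> : 'd P (theta k) (- (eta k *: w k)) = - (eta k *: 'd P (theta k) (w k)).
    by rewrite linearN linearZ.
  by rewrite opprK [RHS]addrC addrA [X in _ = X - _]addrAC subrK addrK.
rewrite -/(w k) => hd.
have hnorm : `|- (eta k *: w k)| <= `|eta k| * enorm (w k).
  by rewrite normrN normrZ ler_wpM2l// enorm_ge.
apply: le_trans (hC (hLip k) _ (le_trans hnorm hd)) _.
rewrite ler_wpM2l ?(ltW C0)//.
by rewrite -(real_normK (num_real (eta k))) -exprMn lerXn2r// nnegrE ?(le_trans _ hnorm).
Qed.
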